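(* Let $A\in\mathbb{R}^{m\times n}$, let $V\in\mathbb{R}^{n\times (k+p)}$ satisfy $V^TV=I$, and let $K=VV^T$. Let $S\subset\{1,2,\dots,n\}$ be an index subset with $|S|=k$ such that $V(S,:)$ has full row rank. Sample $T\sim \mathrm{DPP}(\widetilde K)$, where $$\widetilde K = K-K(:,S)\,K(S,S)^{-1}K(S,:),$$ and let $U=S\cup T$. Then $$\mathbb{E}_T\left[\,\|A-A(:,U)V(U,:)^{-T}V^T\|_F^2 \,\middle|\, S\right]\le (1+p)\,\left\|\widetilde A-\widetilde A(:,S)\,(V^T(:,S))^{\dagger}V^T\right\|_F^2,$$ where $\widetilde A=A-AVV^T$.
   Context: For a matrix $M$ and index sets $I,J$, $M(I,J)$ is the submatrix with rows $I$ and columns $J$; $M(:,J)$ and $M(I,:)$ are the submatrices of all rows (resp. all columns). $M^{\dagger}$ is the Moore–Penrose pseudoinverse, $M^{-T}=(M^{-1})^T$, and $\|\cdot\|_F$ is the Frobenius norm. The same ordering of the elements of $U$ is used in $A(:,U)$ and $V(U,:)$. For a symmetric matrix $K\in\mathbb{R}^{n\times n}$ with $0\preceq K\preceq I$, $\mathrm{DPP}(K)$ (determinantal point process with kernel $K$) is the law of a random subset $X\subseteq\{1,\dots,n\}$ such that $\mathbb{P}(Y\subseteq X)=\det(K(Y,Y))$ for every $Y\subseteq\{1,\dots,n\}$. In the setting of the claim, $\widetilde K$ is an orthogonal projector of rank $p$, so $|T|=p$ almost surely. The notation $\mathbb{E}_T[\cdot\mid S]$ denotes expectation over $T$ with $S$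 fixed. *)

(* Defs.v *)
From HB Require Import structures.
From mathcomp Require Import all_boot all_order all_algebra.

Set Implicit Arguments.
Unset Strict Implicit.
Unset Printing Implicit Defensive.

Import Order.TTheory GRing.Theory Num.Theory.
Local Open Scope ring_scope.

(* The elements of an index set are always listed in the order of [enum], so   *)
(* the same ordering is used in, e.g., [cols U A] and [rows U V].              *)
Definition submx_of (R : Type) (m n : nat) (I : {set 'I_m}) (J : {set 'I_n})
    (M : 'M[R]_(m, n)) : 'M[R]_(#|I|, #|J|) :=
  mxsub (fun i : 'I_#|I| => enum_val i) (fun j : 'I_#|J| => enum_val j) M.

Definition rows (R : Type) (m n : nat) (I : {set 'I_m})
    (M : 'M[R]_(m, n)) : 'M[R]_(#|I|, n) :=
  rowsub (fun i : 'I_#|I| => enum_val i) M.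

Definition cols (R : Type) (m n : nat) (J : {set 'I_n})
    (M : 'M[R]_(m, n)) : 'M[R]_(m, #|J|) :=
  colsub (fun j : 'I_#|J| => enum_val j) M.

(* The inverse of a matrix M which is square only up to a propositional        *)
(* equality r = q of its dimensions. It is [invmx M] if r = q, and the junk    *)
(* value 0 if r != q.                                                          *)
Definition cinvmx (R : comUnitRingType) (r q : nat)
    (M : 'M[R]_(r, q)) : 'M[R]_(q, r) :=
  conform_mx 0 (invmx (conform_mx (0 : 'M[R]_q) M)).

Lemma cinvmx_sq (R : comUnitRingType) (q : nat) (M : 'M[R]_q) :
  cinvmx M = invmx M.
Proof. by rewrite /cinvmx !conform_mx_id. Qed.

Lemma cinvmx_nsq (R : comUnitRingType) (r q : nat) (M : 'M[R]_(r, q)) :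
  r != q -> cinvmx M = 0.
Proof. by move=> ne; rewrite /cinvmx nonconform_mx // [q == r]eq_sym ne orbT. Qed.

Definition frob (R : rcfType) (m n : nat) (M : 'M[R]_(m, n)) : R :=
  Num.sqrt (\sum_i \sum_j M i j ^+ 2).

Definition penrose (R : rcfType) (m n : nat)
    (M : 'M[R]_(m, n)) (X : 'M[R]_(n, m)) : bool :=
  [&& M *m X *m M == M,
      X *m M *m X == X,
      (M *m X)^T == M *m X
    & (X *m M)^T == X *m M].

Lemma mulmx_trmx_eq0 (R : rcfType) (m n : nat) (M : 'M[R]_(m, n)) :
  M *m M^T = 0 -> M = 0.
Proof.
move=> M0; apply/matrixP => i j; rewrite mxE.
have /matrixP/(_ i i) := M0; rewrite !mxE => /eqP.
rewrite psumr_eq0 => [/allP/(_ j (mem_index_enum _)) /=|l _].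
  by rewrite mxE mulf_eq0 orbb => /eqP.
by rewrite mxE -expr2 sqr_ge0.
Qed.

Lemma row_free_gram (R : rcfType) (m n : nat) (M : 'M[R]_(m, n)) :
  row_free M -> M *m M^T \in unitmx.
Proof.
move=> fM; rewrite -row_free_unit -kermx_eq0; apply/eqP.
set Z := kermx _; have Z0 : Z *m (M *m M^T) = 0 by apply: mulmx_ker.
have ZM : Z *m M = 0.
  by apply: mulmx_trmx_eq0; rewrite trmx_mul mulmxA -(mulmxA Z) Z0 mul0mx.
by apply: (row_free_inj fM); rewrite ZM mul0mx.
Qed.

Lemma penrose_exists (R : rcfType) (m n : nat) (M : 'M[R]_(m, n)) :
  exists X, penrose M X.
Proof.
have := mulmx_base M; have := row_base_free M; have := col_base_full M.
move: (\rank M) (col_base M) (row_base M) => r C F fC fF /esym MCF.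
have uF : F *m F^T \in unitmx by apply: row_free_gram.
have uC : C^T *m C \in unitmx.
  rewrite -{2}(trmxK C); apply: row_free_gram.
  by rewrite /row_free mxrank_tr.
pose GF := invmx (F *m F^T); pose GC := invmx (C^T *m C).
have sF : GF^T = GF by rewrite /GF trmx_inv trmx_mul trmxK.
have sC : GC^T = GC by rewrite /GC trmx_inv trmx_mul trmxK.
pose X := F^T *m GF *m GC *m C^T.
have MX : M *m X = C *m GC *m C^T.
  by rewrite MCF /X !mulmxA -(mulmxA C F) -(mulmxA C (F *m _)) mulmxV // mulmx1.
have XM : X *m M = F^T *m GF *m F.
  by rewrite MCF /X !mulmxA -(mulmxA _ C^T) -(mulmxA _ GC) mulVmx // mulmx1.
exists X; apply/and4P; split; apply/eqP.
- by rewrite MX {1}MCF mulmxA -(mulmxA _ C^T) -(mulmxA _ GC) mulVmx // mulmx1.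
- rewrite XM /X !mulmxA -(mulmxA _ F F^T) -(mulmxA _ GF (F *m _)).
  by rewrite mulVmx // mulmx1.
- by rewrite MX !trmx_mul trmxK sC mulmxA.
- by rewrite XM !trmx_mul trmxK sF mulmxA.
Qed.

Lemma penrose_uniq (R : rcfType) (m n : nat) (M : 'M[R]_(m, n)) X Y :
  penrose M X -> penrose M Y -> X = Y.
Proof.
move=> /and4P[/eqP X1 /eqP X2 /eqP X3 /eqP X4].
move=> /and4P[/eqP Y1 /eqP Y2 /eqP Y3 /eqP Y4].
have MXY : M *m X = M *m Y.
  by rewrite -X3 -{1}Y1 -mulmxA trmx_mul X3 Y3 mulmxA X1.
have XYM : X *m M = Y *m M.
  by rewrite -X4 -{1}Y1 -(mulmxA M) mulmxA trmx_mul X4 Y4 -mulmxA (mulmxA M) X1.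
by rewrite -X2 XYM -mulmxA MXY mulmxA Y2.
Qed.

(* The Moore-Penrose pseudoinverse; mathcomp's [pinvmx] is only some           *)
(* generalized inverse and need not satisfy the symmetry conditions.           *)
Definition mppinv (R : rcfType) (m n : nat) (M : 'M[R]_(m, n)) : 'M[R]_(n, m) :=
  xchoose (penrose_exists M).

Lemma mppinvP (R : rcfType) (m n : nat) (M : 'M[R]_(m, n)) :
  penrose M (mppinv M).
Proof. exact: xchooseP. Qed.

(* mu is the probability mass function on the subsets of 'I_n of a random set  *)
(* X with P(Y \subset X) = det K(Y, Y) for all Y. These marginals determine    *)
(* mu; that K is symmetric with 0 <= K <= I is what makes mu exist.            *)
Definition is_DPP (R : rcfType) (n : nat) (K : 'M[R]_n)
    (mu : {set 'I_n} -> R) : Prop :=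
  [/\ forall X, 0 <= mu X,
      \sum_X mu X = 1
    & forall Y : {set 'I_n},
        \sum_(X : {set 'I_n} | Y \subset X) mu X = \det (submx_of Y Y K)].

Definition expect (R : rcfType) (n : nat) (mu : {set 'I_n} -> R)
    (f : {set 'I_n} -> R) : R :=
  \sum_T mu T * f T.

(* Main.v *)
(* Let P = I - V_S^T (V_S^T)^+ be the orthogonal projector onto the kernel of  *)
(* V_S = V(S, :), so that Kt = V P V^T, and let B be the residual on the right *)
(* hand side. Interpolating at U = S + T leaves the error                      *)
(*   B - B_T Kt_TT^-1 Kt_T,                                                    *)
(* whose two terms are orthogonal because B V P = 0. It remains to see that    *)
(* the expected squared norm of the second term is at most p |B|^2. Write      *)
(* Kt = W G W^T with G = (W^T W)^-1, so that mu(T) = det G det(W_T)^2. For a   *)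
(* row b of B and a row w_j of W, the (b, j) entry x of the second term        *)
(* satisfies                                                                   *)
(*   det(W_T) x = det(W_T + b_T^T w_j) - det(W_T),                             *)
(* and by Cauchy-Binet the squares of these numbers, multiplied by det G, sum  *)
(* over all T of size p to |b|^2 Kt_jj, because b W = 0. Summing over b and j  *)
(* gives |B|^2 tr Kt = p |B|^2.                                                *)

Require Import Defs.
From mathcomp Require Import all_boot all_order all_algebra perm ring.

Set Implicit Arguments.
Unset Strict Implicit.

Import Order.TTheory GRing.Theory Num.Theory.
Local Open Scope ring_scope.

(** The factor [1 + p] splits into two contributions. For every [T] of positive mass,
    [interpolation_error] writes the error as [B] minus a correction, and [frob_sqrB_orth] separates
    their squared norms: [B] accounts for the 1. By [DPP_expect_le] the correction accounts for [p],
    the trace of [Kt]. That bound is an inequality because sets [T] with singular [W_T] have no mass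
    but may contribute to the Cauchy-Binet sum. Sets of positive mass have size [p] and a nonzero
    minor ([DPP_support], [DPP_pmf]), which makes [V(U, :)] invertible. *)

(** * Cauchy-Binet and determinants of rank-one updates *)

Lemma det_cols_rows (R : comNzRingType) (n r : nat) (T : {set 'I_n})
    (N : 'M[R]_(r, n)) (M : 'M[R]_(n, r)) :
  \det (cols T N *m rows T M) =
  \sum_(f : {ffun 'I_r -> 'I_n} | f \in ffun_on (mem T))
    (\prod_i N i (f i)) * \det (rowsub f M).
Proof.
transitivity (\sum_(s : 'S_r) \sum_(f : {ffun 'I_r -> 'I_n} | f \in ffun_on (mem T))
    (-1) ^+ s * \prod_i (N i (f i) * M (f i) (s i))).
  apply: eq_bigr => s _; rewrite -big_distrr /=; congr (_ * _).
  rewrite -(bigA_distr_big (mem T) (fun i j => N i j * M j (s i))) /=.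
  apply: eq_bigr => i _; rewrite mxE [RHS]big_enum_val.
  by apply: eq_bigr => j _; rewrite !mxE.
rewrite exchange_big; apply: eq_bigr => f _.
rewrite big_distrr; apply: eq_bigr => s _; rewrite /= mulrCA big_split /=.
by congr (_ * (_ * _)); apply: eq_bigr => i _; rewrite mxE.
Qed.

(* Both sides are expanded over the maps f : 'I_r -> 'I_n. Only the injective  *)
(* ones contribute, and the image of such an f is the only set T of size r     *)
(* that contains all the values of f.                                          *)
Lemma cauchy_binet (R : comNzRingType) (n r : nat)
    (N : 'M[R]_(r, n)) (M : 'M[R]_(n, r)) :
  \sum_(T : {set 'I_n} | #|T| == r) \det (cols T N *m rows T M) =
  \det (N *m M).
Proof.
have -> : \det (N *m M) = \sum_(f : {ffun 'I_r -> 'I_n})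
    (\prod_i N i (f i)) * \det (rowsub f M).
  have -> : N *m M = cols setT N *m rows setT M.
    apply/matrixP => i j; rewrite !mxE.
    transitivity (\sum_(k in [set: 'I_n]) N i k * M k j).
      by apply: eq_bigl => k; rewrite inE.
    by rewrite big_enum_val; apply: eq_bigr => k _; rewrite !mxE.
  rewrite det_cols_rows; apply: eq_bigl => f.
  by apply/ffun_onP => i; rewrite inE.
under eq_bigr do rewrite det_cols_rows.
rewrite (exchange_big_dep xpredT) //=; apply: eq_bigr => f _.
have [/injectiveP injf | /injectivePn[i [j ij fij]]] := boolP (injectiveb f).
  rewrite (big_pred1 [set f i | i : 'I_r]) // => T.
  apply/andP/eqP => [[/eqP cT /ffun_onP fT] | ->].
    apply/eqP; rewrite eq_sym eqEcard card_imset // card_ord cT leqnn andbT.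
    by apply/subsetP => _ /imsetP[i _ ->]; apply: fT.
  rewrite card_imset // card_ord eqxx; split=> //.
  by apply/ffun_onP => i; apply: imset_f.
have -> : \det (rowsub f M) = 0.
  by apply: (determinant_alternate ij) => l; rewrite !mxE fij.
by rewrite mulr0 big1.
Qed.

(** The same two block triangular or bordered matrices are multiplied in both orders; the products
    have equal determinants. *)
Lemma det_add1_rank1 (R : comNzRingType) (r : nat) (u : 'cV[R]_r) (v : 'rV[R]_r) :
  \det (1%:M + u *m v) = 1 + (v *m u) 0 0.
Proof.
have E1 : block_mx 1%:M (- v) u 1%:M *m block_mx 1%:M v 0 1%:M
    = block_mx 1%:M 0 u (1%:M + u *m v).
  by rewrite mulmx_block !mul1mx !mulmx1 !mulmx0 !addr0 addrN addrC.
have E2 : block_mx 1%:M v 0 1%:M *m block_mx 1%:M (- v) u 1%:M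
    = block_mx (1%:M + v *m u) 0 u 1%:M.
  by rewrite mulmx_block !mul1mx !mulmx1 !mul0mx !add0r addNr.
have := congr1 determinant E1; have := congr1 determinant E2.
rewrite !det_mulmx !det_lblock det_ublock !det1 !mul1r !mulr1 => -> <-.
by rewrite det_mx11 !mxE eqxx.
Qed.

(** * Frobenius norm and submatrices of products *)

Lemma frob_sqr (R : rcfType) (m n : nat) (M : 'M[R]_(m, n)) :
  frob M ^+ 2 = \sum_i \sum_j M i j ^+ 2.
Proof.
rewrite sqr_sqrtr // sumr_ge0 // => i _.
by rewrite sumr_ge0 // => j _; rewrite sqr_ge0.
Qed.

Lemma frob_sqr_tr (R : rcfType) (m n : nat) (M : 'M[R]_(m, n)) :
  frob M ^+ 2 = \tr (M *m M^T).
Proof.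
rewrite frob_sqr; apply: eq_bigr => i _; rewrite mxE.
by apply: eq_bigr => j _; rewrite mxE expr2.
Qed.

Lemma frob_sqrB_orth (R : rcfType) (m n : nat) (M N : 'M[R]_(m, n)) :
  M *m N^T = 0 -> frob (M - N) ^+ 2 = frob M ^+ 2 + frob N ^+ 2.
Proof.
move=> MN; have NM : N *m M^T = 0 by rewrite -[LHS]trmxK trmx_mul trmxK MN trmx0.
rewrite !frob_sqr_tr linearB /= mulmxBr !mulmxBl MN NM subr0 sub0r opprK.
by rewrite linearD.
Qed.

Lemma submx_of_mul (R : nzRingType) (m n q : nat) (I : {set 'I_m}) (J : {set 'I_n})
    (M : 'M[R]_(m, q)) (N : 'M[R]_(q, n)) :
  submx_of I J (M *m N) = rows I M *m cols J N.
Proof. exact: mxsub_mul. Qed.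

Lemma rows_mul (R : nzRingType) (m n q : nat) (I : {set 'I_m})
    (M : 'M[R]_(m, q)) (N : 'M[R]_(q, n)) :
  rows I (M *m N) = rows I M *m N.
Proof. exact/esym/mul_rowsub_mx. Qed.

Lemma cols_mul (R : nzRingType) (m n q : nat) (J : {set 'I_n})
    (M : 'M[R]_(m, q)) (N : 'M[R]_(q, n)) :
  cols J (M *m N) = M *m cols J N.
Proof. exact/esym/mulmx_colsub. Qed.

Lemma det_submx_of_set1 (R : comNzRingType) (n : nat) (K : 'M[R]_n) (i : 'I_n) :
  \det (submx_of [set i] [set i] K) = K i i.
Proof.
have det1x q (M : 'M[R]_q) x : q = 1 -> (forall a b, M a b = x) -> \det M = x.
  by move=> q1; subst q => Mx; rewrite det_mx11 Mx.
apply: det1x; first exact: cards1.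
by move=> a b; rewrite mxE !(set1P (enum_valP _)).
Qed.

(** * Determinantal processes whose kernel is an idempotent of rank [r] *)

Section RankDPP.
Variables (R : rcfType) (n r : nat) (W : 'M[R]_(n, r)) (Z : 'M[R]_(r, n)).
Variable mu : {set 'I_n} -> R.
Hypothesis ZW : Z *m W = 1%:M.
Hypothesis muK : is_DPP (W *m Z) mu.
Let K := W *m Z.

Lemma det_minor_large (T : {set 'I_n}) :
  (r < #|T|)%N -> \det (submx_of T T K) = 0.
Proof.
move=> rT; apply/eqP; rewrite -[_ == 0]negbK -unitfE -unitmxE -row_free_unit.
rewrite /row_free submx_of_mul neq_ltn orbC ltnNge rank_leq_row /=.
apply: leq_ltn_trans rT; apply: leq_trans (mxrankM_maxl _ _) _.
exact: rank_leq_col.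
Qed.

(** Sizes above [r] have mass 0 because those minors of [K] vanish, and the mean size is
    [\tr K = r]. A size bounded by its mean equals it almost surely. *)
Lemma DPP_support (T : {set 'I_n}) : mu T != 0 -> #|T| = r.
Proof.
case: muK => mu0 mu1 muS muT.
have mu_large (X : {set _}) : (r < #|X|)%N -> mu X = 0.
  move=> rX; apply/eqP; rewrite eq_le mu0 andbT -(det_minor_large rX) -muS.
  by rewrite (bigD1 X) //= lerDl sumr_ge0.
have mean : \sum_X mu X * #|X|%:R = r%:R.
  transitivity (\tr K); last by rewrite mxtrace_mulC ZW mxtrace1.
  transitivity (\sum_(X : {set 'I_n}) \sum_(i in X) mu X).
    by apply: eq_bigr => X _; rewrite sumr_const mulr_natr.
  rewrite (exchange_big_dep xpredT) //=; apply: eq_bigr => i _.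
  rewrite -det_submx_of_set1 -muS.
  by apply: eq_bigl => X; rewrite sub1set.
have /eqP : \sum_X mu X * r%:R = \sum_X mu X * #|X|%:R.
  by rewrite mean -big_distrl /= mu1 mul1r.
rewrite -subr_eq0 -sumrB psumr_eq0 => [/allP/(_ T (mem_index_enum _))/=|X _].
  by rewrite -mulrBr mulf_eq0 (negPf muT) subr_eq0 eqr_nat => /eqP.
have [/mu_large->|Xr] := ltnP r #|X|; first by rewrite !mul0r subr0.
by rewrite -mulrBr mulr_ge0 // subr_ge0 ler_nat.
Qed.

(** Among the supersets of [T], only [T] itself has size [r]. *)
Lemma DPP_pmf (T : {set 'I_n}) : #|T| = r -> mu T = \det (submx_of T T K).
Proof.
case: muK => mu0 mu1 muS Tr.
rewrite -muS (bigD1 T) //= big1 ?addr0 // => X /andP[TX XT].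
apply/eqP; apply: contraNT XT => /DPP_support Xr.
by rewrite eq_sym eqEcard TX Xr Tr leqnn.
Qed.

End RankDPP.

(* Only meaningful if #|T| = r: otherwise this is the junk value \det 0. *)
Definition row_minor (R : comNzRingType) (n r : nat) (T : {set 'I_n})
    (M : 'M[R]_(n, r)) : R :=
  \det (conform_mx (0 : 'M[R]_r) (rows T M)).

Lemma det_cols_rows_minor (R : comNzRingType) (n r : nat) (T : {set 'I_n})
    (N M : 'M[R]_(n, r)) : #|T| = r ->
  \det (cols T N^T *m rows T M) = row_minor T N * row_minor T M.
Proof.
move=> Tr; subst r; rewrite /row_minor !conform_mx_id.
by rewrite /cols -trmx_mxsub det_mulmx det_tr.
Qed.

Lemma cauchy_binet_minor (R : comNzRingType) (n r : nat) (N M : 'M[R]_(n, r)) :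
  \sum_(T : {set 'I_n} | #|T| == r) row_minor T N * row_minor T M =
  \det (N^T *m M).
Proof.
rewrite -cauchy_binet; apply: eq_bigr => T /eqP Tr.
by rewrite det_cols_rows_minor.
Qed.

Lemma det_gram_ge0 (R : rcfType) (n r : nat) (W : 'M[R]_(n, r)) :
  0 <= \det (W^T *m W).
Proof.
by rewrite -cauchy_binet_minor sumr_ge0 // => T _; rewrite -expr2 sqr_ge0.
Qed.

(** * Second moment of the correction term *)

Section ProjectionDPP.
Variables (R : rcfType) (n r : nat) (W : 'M[R]_(n, r)) (G : 'M[R]_r).
Hypothesis GW : G *m (W^T *m W) = 1%:M.
Let K := W *m (G *m W^T).

Let detGW : \det G * \det (W^T *m W) = 1.
Proof. by rewrite -det_mulmx GW det1. Qed.

Let detG_ge0 : 0 <= \det G.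
Proof.
have := det_gram_ge0 W; rewrite le_eqVlt => /predU1P[W0 | W_gt0].
  by have := detGW; rewrite -W0 mulr0 => /eqP; rewrite eq_sym oner_eq0.
by rewrite -(pmulr_lge0 _ W_gt0) detGW ler01.
Qed.

(** As [b *m W = 0], the cross Gram matrix of [W] and its update [M] is still [W^T *m W]. Expanding
    the square leaves a difference of two Gram determinants, whose matrices differ by rank one. *)
Lemma sum_minor_rank1 (b : 'rV[R]_n) (j : 'I_n) : b *m W = 0 ->
  \sum_(T : {set 'I_n} | #|T| == r)
    \det G * (row_minor T (W + b^T *m row j W) - row_minor T W) ^+ 2 =
  (b *m b^T) 0 0 * K j j.
Proof.
move=> bW; set w := row j W; set M := W + b^T *m w.
have Wb : W^T *m b^T = 0 by rewrite -trmx_mul bW trmx0.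
have WM : W^T *m M = W^T *m W by rewrite mulmxDr mulmxA Wb mul0mx addr0.
have MW : M^T *m W = W^T *m W by rewrite -[LHS]trmxK trmx_mul trmxK WM trmx_mul trmxK.
have MM : M^T *m M = W^T *m W + w^T *m (b *m b^T *m w).
  rewrite mulmxDr MW; congr (_ + _).
  by rewrite linearD /= trmx_mul trmxK mulmxDl !mulmxA Wb mul0mx add0r.
transitivity (\det G * (\det (M^T *m M) - \det (W^T *m W))).
  rewrite -big_distrr /=; congr (_ * _).
  transitivity (\det (M^T *m M) - \det (M^T *m W) - \det (W^T *m M)
      + \det (W^T *m W)); last by rewrite MW WM subrK.
  rewrite -!cauchy_binet_minor -!sumrB -big_split /=; apply: eq_bigr => T _.
  by ring.
rewrite mulrBr detGW -det_mulmx MM mulmxDr GW (mulmxA G) det_add1_rank1 addrC addKr.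
rewrite -[_ *m w *m _]mulmxA mxE big_ord1; congr (_ * _).
rewrite [LHS]mxE [RHS]mxE; apply: eq_bigr => l _; rewrite !mxE; congr (_ * _).
by apply: eq_bigr => i _; rewrite !mxE.
Qed.

(** Equality holds when [rows T W] is invertible, by [det_add1_rank1]; otherwise the left side is 0
    and the right side is nonnegative. *)
Lemma DPP_entry_le (b : 'rV[R]_n) (j : 'I_n) (T : {set 'I_n}) : #|T| = r ->
  \det (submx_of T T K) *
    (cols T b *m invmx (submx_of T T K) *m rows T K) 0 j ^+ 2 <=
  \det G * (row_minor T (W + b^T *m row j W) - row_minor T W) ^+ 2.
Proof.
move: (detG_ge0); rewrite /K; clear GW K detGW detG_ge0.
move=> G0 Tr; subst r; rewrite /row_minor !conform_mx_id.
set W' := rows T W; set w := row j W.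
have -> : rows T (W + b^T *m w) = W' + (cols T b)^T *m w.
  apply/matrixP => s t; rewrite !mxE; congr (_ + _).
  by apply: eq_bigr => l _; rewrite !mxE.
have KT : submx_of T T (W *m (G *m W^T)) = W' *m (G *m W'^T).
  by rewrite submx_of_mul cols_mul /cols -trmx_mxsub.
have detK : \det (submx_of T T (W *m (G *m W^T))) = \det G * \det W' ^+ 2.
  by rewrite KT !det_mulmx det_tr mulrCA expr2.
rewrite detK; have [W0 | W0] := eqVneq (\det W') 0.
  by rewrite W0 expr0n mulr0 mul0r mulr_ge0 ?sqr_ge0.
have uW : W' \in unitmx by rewrite unitmxE unitfE.
set c := (cols T b)^T; set e := (w *m (invmx W' *m c)) 0 0.
have -> : W' + c *m w = W' *m (1%:M + invmx W' *m c *m w).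
  by rewrite mulmxDr mulmx1 !mulmxA mulmxV // mul1mx.
rewrite det_mulmx det_add1_rank1 -/e mulrDr mulr1 addrC addKr exprMn -mulrA.
(* [GW] was cleared to substitute [r], so a zero [\det G] is treated here; both sides then
   vanish. *)
have [G00 | Gn0] := eqVneq (\det G) 0; first by rewrite G00 !mul0r.
have uK : submx_of T T (W *m (G *m W^T)) \in unitmx.
  by rewrite unitmxE unitfE detK mulf_neq0 ?expf_neq0.
suff -> : (cols T b *m invmx (submx_of T T (W *m (G *m W^T)))
    *m rows T (W *m (G *m W^T))) 0 j = e by [].
have -> : rows T (W *m (G *m W^T)) =
    submx_of T T (W *m (G *m W^T)) *m (invmx W'^T *m W^T).
  by rewrite KT rows_mul -!mulmxA (mulKVmx _) ?unitmx_tr.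
rewrite mulmxA mulmxKV // -[cols T b]trmxK -/c -trmx_inv -!trmx_mul mxE.
by rewrite -mulmxA /e -row_mul [RHS]mxE.
Qed.

Lemma DPP_expect_le (m : nat) (B : 'M[R]_(m, n)) (mu : {set 'I_n} -> R) :
  is_DPP K mu -> B *m W = 0 ->
  \sum_T mu T *
    frob (cols T B *m invmx (submx_of T T K) *m rows T K) ^+ 2 <=
  r%:R * frob B ^+ 2.
Proof.
move=> muK BW; have ZW : G *m W^T *m W = 1%:M by rewrite -mulmxA.
have -> : r%:R * frob B ^+ 2 = \sum_i \sum_j (row i B *m (row i B)^T) 0 0 * K j j.
  have <- : \tr K = r%:R by rewrite mxtrace_mulC ZW mxtrace1.
  rewrite frob_sqr_tr mulrC big_distrl /=; apply: eq_bigr => i _.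
  rewrite big_distrr /=; apply: eq_bigr => j _; congr (_ * _).
  by rewrite !mxE; apply: eq_bigr => l _; rewrite !mxE.
rewrite (bigID (fun T : {set 'I_n} => #|T| == r)) /= [X in _ + X]big1 ?addr0; last first.
  move=> T Tr; have [->|muT] := eqVneq (mu T) 0; first by rewrite mul0r.
  by rewrite (DPP_support ZW muK muT) eqxx in Tr.
(* Each product of a squared row norm and [K j j] becomes a sum over [T], so the two sides can be
   compared for each [T], entry by entry. *)
under [leRHS]eq_bigr => i _.
  under eq_bigr => j _.
    rewrite -sum_minor_rank1; last by rewrite -row_mul BW row0.
    over.
  rewrite exchange_big /=; over.
rewrite exchange_big /=; apply: ler_sum => T /eqP Tr.
rewrite frob_sqr big_distrr /=; apply: ler_sum => i _.
rewrite big_distrr /=; apply: ler_sum => j _.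
rewrite (DPP_pmf ZW muK) //.
have -> : (cols T B *m invmx (submx_of T T K) *m rows T K) i j =
    (cols T (row i B) *m invmx (submx_of T T K) *m rows T K) 0 j.
  rewrite -!mulmxA !mxE; apply: eq_bigr => l _; congr (_ * _).
  by rewrite !mxE.
exact: DPP_entry_le.
Qed.

End ProjectionDPP.

(** * The complementary projector and interpolation at [S :|: T] *)

Lemma cols_eqP (R : nzRingType) (m n : nat) (J : {set 'I_n}) (M N : 'M[R]_(m, n)) :
  cols J M = cols J N <-> forall i j, j \in J -> M i j = N i j.
Proof.
split=> [/matrixP MN i j jJ | MN].
  by have := MN i (enum_rank_in jJ j); rewrite !mxE enum_rankK_in.
by apply/matrixP => i j; rewrite !mxE MN ?enum_valP.
Qed.

Lemma cols_setU (R : nzRingType) (m n : nat) (S T : {set 'I_n})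
    (M N : 'M[R]_(m, n)) :
  cols (S :|: T) M = cols (S :|: T) N <->
  cols S M = cols S N /\ cols T M = cols T N.
Proof.
rewrite !cols_eqP; split=> [MN | [MS MT] i j].
  by split=> i j jJ; rewrite MN // inE jJ ?orbT.
by rewrite inE => /orP[/MS | /MT].
Qed.

Lemma trmx_rows (R : nzRingType) (m n : nat) (I : {set 'I_m}) (M : 'M[R]_(m, n)) :
  (rows I M)^T = cols I M^T.
Proof. exact: trmx_mxsub. Qed.

Lemma cinvmxVK (R : fieldType) (r q : nat) (M : 'M[R]_(r, q)) :
  r = q -> row_free M^T -> cinvmx M *m M = 1%:M.
Proof.
move=> rq; subst q; rewrite row_free_unit unitmx_tr => uM.
by rewrite cinvmx_sq mulVmx.
Qed.

Lemma mppinv_row_free (R : rcfType) (m n : nat) (M : 'M[R]_(m, n)) :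
  row_free M -> mppinv M^T = invmx (M *m M^T) *m M.
Proof.
move=> /row_free_gram uM; apply: penrose_uniq (mppinvP _) _.
have E : invmx (M *m M^T) *m M *m M^T = 1%:M by rewrite -mulmxA mulVmx.
have sG : (invmx (M *m M^T))^T = invmx (M *m M^T).
  by rewrite trmx_inv trmx_mul trmxK.
apply/and4P; split; apply/eqP.
- by rewrite -mulmxA E mulmx1.
- by rewrite E mul1mx.
- by rewrite !trmx_mul trmxK sG mulmxA.
- by rewrite E trmx1.
Qed.

(** The rows of [C] form a basis of the row space of [P], with the Gram inverse in place of
    orthonormalization. Writing [P = D *m C], the identity [C *m P = C] and symmetry determine
    [D]. *)
Lemma sym_idem_factor (R : rcfType) (q : nat) (P : 'M[R]_q) :
  P^T = P -> P *m P = P ->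
  exists (r : nat) (C : 'M[R]_(r, q)),
    C *m C^T \in unitmx /\ P = C^T *m invmx (C *m C^T) *m C.
Proof.
move=> sP PP; exists (\rank P), (row_base P); set C := row_base P; set D := col_base P.
have uC : C *m C^T \in unitmx by apply/row_free_gram/row_base_free.
have PDC : P = D *m C by rewrite mulmx_base.
have /submxP[X CX] : (C <= P)%MS by rewrite eq_row_base.
have CP : C *m P = C by rewrite CX -mulmxA PP.
have DCC : D *m (C *m C^T) = C^T.
  by rewrite mulmxA -PDC; have := congr1 trmx CP; rewrite trmx_mul sP.
have DE : D = C^T *m invmx (C *m C^T) by rewrite -[LHS](mulmxK uC) DCC.
by rewrite -DE.
Qed.

Section Interpolation.
Variables (R : rcfType) (m n k p : nat).
Variables (A : 'M[R]_(m, n)) (V : 'M[R]_(n, k + p)) (S : {set 'I_n}).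
Hypotheses (VV : V^T *m V = 1%:M) (cardS : #|S| = k).
Hypothesis freeVS : row_free (rows S V).

Let VS := rows S V.
Let K : 'M[R]_n := V *m V^T.
Let Kt : 'M[R]_n := K - cols S K *m invmx (submx_of S S K) *m rows S K.
Let At : 'M[R]_(m, n) := A - A *m V *m V^T.
Let L := mppinv (cols S V^T).
Let P := 1%:M - VS^T *m L.
Let B := At - cols S At *m L *m V^T.

Let LE : L = invmx (VS *m VS^T) *m VS.
Proof. by rewrite /L -trmx_rows mppinv_row_free. Qed.

Let uVS : VS *m VS^T \in unitmx. Proof. exact: row_free_gram. Qed.

Let LVS : L *m VS^T = 1%:M. Proof. by rewrite LE -mulmxA mulVmx. Qed.

Let PVS : P *m VS^T = 0.
Proof. by rewrite mulmxBl mul1mx -mulmxA LVS mulmx1 subrr. Qed.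

Let LP : L *m P = 0.
Proof. by rewrite mulmxBr mulmx1 mulmxA LVS mul1mx subrr. Qed.

Lemma compl_proj_sym : P^T = P.
Proof.
rewrite /P LE linearB /= trmx1 !trmx_mul trmxK trmx_inv trmx_mul trmxK.
by rewrite mulmxA.
Qed.

Lemma compl_proj_idem : P *m P = P.
Proof. by rewrite {2}/P mulmxBr mulmx1 mulmxA PVS mul0mx subr0. Qed.

(** The rank of a projector is its trace, here [(k + p) - k]. *)
Lemma compl_proj_factor :
  exists C : 'M[R]_(p, k + p),
    C *m C^T \in unitmx /\ P = C^T *m invmx (C *m C^T) *m C.
Proof.
have [r [C [uC PC]]] := sym_idem_factor compl_proj_sym compl_proj_idem.
suff rp : r = p by subst r; exists C.
have : \tr P = r%:R.
  by rewrite PC -mulmxA mxtrace_mulC -mulmxA mulVmx // mxtrace1.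
rewrite /P linearB /= mxtrace_mulC LVS !mxtrace1 cardS natrD addrC addKr.
by move/eqP; rewrite eqr_nat => /eqP.
Qed.

Lemma residual_kernel : Kt = V *m P *m V^T.
Proof.
rewrite /P mulmxBr mulmx1 mulmxBl LE.
congr (_ - _); rewrite /K cols_mul rows_mul submx_of_mul -trmx_rows -/VS.
by rewrite !mulmxA.
Qed.

Lemma residual_mulV : B *m V = - (cols S At *m L).
Proof.
have AtV : At *m V = 0 by rewrite mulmxBl -!mulmxA VV mulmx1 subrr.
by rewrite /B mulmxBl AtV -(mulmxA _ V^T) VV mulmx1 sub0r.
Qed.

Lemma residual_mulVP : B *m V *m P = 0.
Proof. by rewrite residual_mulV mulNmx -mulmxA LP mulmx0 oppr0. Qed.

(* Any X with (X V^T)(:, U) = A(:, U) is the matrix A(:, U) V(U, :)^-T, and   *)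
(* such an X can be written down explicitly.                                  *)
Lemma interpolation_error (T : {set 'I_n}) :
  #|T| = p -> \det (submx_of T T Kt) != 0 ->
  let U := S :|: T in
  A - cols U A *m (cinvmx (rows U V))^T *m V^T =
  B - cols T B *m invmx (submx_of T T Kt) *m rows T Kt.
Proof.
move=> cardT detT U.
have uT : submx_of T T Kt \in unitmx by rewrite unitmxE unitfE.
have KtT : submx_of T T Kt = rows T V *m P *m (rows T V)^T.
  by rewrite residual_kernel submx_of_mul rows_mul trmx_rows.
have KtR : rows T Kt = rows T V *m P *m V^T.
  by rewrite residual_kernel !rows_mul.
pose Y := cols T B *m invmx (submx_of T T Kt) *m (rows T V *m P).
(* The first two terms interpolate on [S] and leave the residual [B]. [Y] repairs the columns in [T]
   without disturbing those in [S], since [P *m VS^T = 0]. *)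
pose X := A *m V + cols S At *m L + Y.
have XU : cols U (X *m V^T) = cols U A.
  have colsB (J : {set 'I_n}) (M N : 'M[R]_(m, n)) :
      cols J (M - N) = cols J M - cols J N by apply/matrixP => i j; rewrite !mxE.
  apply/cols_setU; split; rewrite cols_mul -trmx_rows !mulmxDl.
    rewrite -(mulmxA _ L) LVS mulmx1 /Y -!mulmxA PVS !mulmx0 addr0.
    by rewrite /At colsB cols_mul -trmx_rows -/VS !mulmxA subrKC.
  rewrite /Y -(mulmxA _ (rows T V *m P)) -KtT mulmxKV // /B !colsB !cols_mul.
  by rewrite -!trmx_rows -[_ - _ - _]addrA -opprD subrKC.
(* A vector [u] killed on [S] is fixed by [P], hence a combination of the rows of [C]. The
   invertible minor of [Kt] factors through [C *m (rows T V)^T], so vanishing on [T] forces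
   [u = 0]. *)
have freeU : row_free (rows U V)^T.
  have [C [uC PC]] := compl_proj_factor.
  apply: inj_row_free => u; rewrite trmx_rows -cols_mul.
  have cols0 (J : {set 'I_n}) : cols J 0 = 0 :> 'M[R]_(1, _).
    by apply/matrixP => i j; rewrite !mxE.
  rewrite -(cols0 U).
  move=> /cols_setU[]; rewrite !cols_mul -!trmx_rows -/VS !cols0.
  move=> uS uTV; have uP : u = u *m P.
    rewrite -[P]compl_proj_sym /P linearB /= trmx_mul trmxK trmx1 mulmxBr mulmx1.
    by rewrite LE trmx_mul !mulmxA uS !mul0mx subr0.
  pose y := u *m (C^T *m invmx (C *m C^T)).
  have uy : u = y *m C by rewrite /y -mulmxA -PC.
  have freeC : row_free (C *m (rows T V)^T).
    rewrite /row_free eqn_leq rank_leq_row /=.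
    apply: leq_trans (eq_leq (esym cardT)) _.
    move: uT; rewrite -row_free_unit => /eqP {1}<-.
    by rewrite KtT PC !mulmxA -(mulmxA _ C) mxrankM_maxr.
  have y0 : y = 0 by apply: (row_free_inj freeC); rewrite mulmxA -uy uTV mul0mx.
  by rewrite uy y0 mul0mx.
(* The rank gives the lower bound; with this size [cinvmx] is a true inverse. *)
have cardU : #|U| = (k + p)%N.
  apply/eqP; rewrite eqn_leq; apply/andP; split.
    by rewrite cardsU cardS cardT leq_subr.
  by move/eqP: freeU => {1}<-; rewrite rank_leq_col.
have -> : cols U A *m (cinvmx (rows U V))^T = X.
  rewrite -XU cols_mul -trmx_rows -mulmxA -trmx_mul cinvmxVK //.
  by rewrite trmx1 mulmx1.
rewrite /X !mulmxDl /Y -(mulmxA _ (rows T V *m P) V^T) -KtR /B /At.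
by rewrite !opprD !addrA.
Qed.

End Interpolation.

Set Strict Implicit.
Unset Implicit Arguments.

Theorem theorem3p1 (R : rcfType) (m n k p : nat)
    (A : 'M[R]_(m, n)) (V : 'M[R]_(n, k + p)) (S : {set 'I_n})
    (mu : {set 'I_n} -> R) :
  V^T *m V = 1%:M ->
  #|S| = k ->
  row_free (rows S V) ->
  let K : 'M[R]_n := V *m V^T in
  let Kt : 'M[R]_n := K - cols S K *m invmx (submx_of S S K) *m rows S K in
  is_DPP Kt mu ->
  let At : 'M[R]_(m, n) := A - A *m V *m V^T in
  expect mu (fun T : {set 'I_n} =>
    let U := S :|: T in
    (* mu is supported on the T with #|U| = k + p and rows U V invertible *)
    frob (A - cols U A *m (cinvmx (rows U V))^T *m V^T) ^+ 2)
  <= (1 + p)%:R * frob (At - cols S At *m mppinv (cols S V^T) *m V^T) ^+ 2.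
Proof.
move=> VV cardS freeVS K Kt muKt; cbv zeta.
set At := A - A *m V *m V^T; set B := At - _.
have KtE := residual_kernel freeVS; rewrite -/K -/Kt in KtE.
have BVP := residual_mulVP A VV freeVS.
rewrite -/At -/B in BVP.
have [C [uC]] := compl_proj_factor cardS freeVS.
move: KtE BVP; set P := 1%:M - _ => KtE BVP PC.
pose W := V *m C^T; pose G := invmx (C *m C^T).
have GW : G *m (W^T *m W) = 1%:M.
  by rewrite /W trmx_mul trmxK -mulmxA (mulmxA V^T) VV mul1mx mulVmx.
have KtW : Kt = W *m (G *m W^T).
  by rewrite KtE PC /W trmx_mul trmxK !mulmxA.
have BW : B *m W = 0.
  have CP : P *m C^T = C^T by rewrite PC -!mulmxA mulVmx // mulmx1.
  by rewrite /W -CP !mulmxA BVP mul0mx.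
have ZW : G *m W^T *m W = 1%:M by rewrite -mulmxA.
have muW : is_DPP (W *m (G *m W^T)) mu by rewrite -KtW.
have [_ mu1 _] := muW.
have bound := DPP_expect_le GW muW BW.
rewrite -KtW in bound.
rewrite natrD mulrDl mul1r; apply: le_trans (lerD (lexx _) bound).
rewrite -[X in _ <= X + _]mul1r -mu1 big_distrl -big_split /=.
(* Null sets are discarded first, as the interpolation formula may fail on them. *)
apply: ler_sum => T _; have [->|muT] := eqVneq (mu T) 0.
  by rewrite !mul0r addr0.
have cardT := DPP_support ZW muW muT.
have detT : \det (submx_of T T Kt) != 0.
  by rewrite KtW -(DPP_pmf ZW muW).
rewrite -mulrDr.
have -> := interpolation_error A cardS freeVS cardT detT; rewrite -/K -/Kt -/At -/B.
(* Orthogonality of the two terms: [B] times the transpose of [rows T Kt] contains the factor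
   [B *m V *m P = 0]. *)
rewrite frob_sqrB_orth // [in rows T Kt]KtE !rows_mul.
have PT : P^T = P by exact: compl_proj_sym.
by rewrite !trmx_mul trmxK PT !mulmxA BVP !mul0mx.
Qed.
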